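(* Let $r \geq 1$ be an integer and let $\mathbb{F}_{3^r}$ be the finite field with $3^r$ elements. There are no Alltop type polynomials over $\mathbb{F}_{3^r}$; that is, there is no polynomial $f \in \mathbb{F}_{3^r}[x]$ such that for every $a \in \mathbb{F}_{3^r}^*$ the function $\Delta_{fa}: x \mapsto f(x+a) - f(x)$ is a planar function on $\mathbb{F}_{3^r}$.
   Context: Let $\mathbb{F}$ be a finite field and $\mathbb{F}^* = \mathbb{F}\setminus\{0\}$. For a function $f:\mathbb{F}\to\mathbb{F}$ and $a \in \mathbb{F}$, write $\Delta_{fa}(x) = f(x+a) - f(x)$. A function $\Pi : \mathbb{F} \to \mathbb{F}$ is called planar if for every $b \in \mathbb{F}^*$ the function $x \mapsto \Pi(x+b) - \Pi(x)$ is a bijection of $\mathbb{F}$; a planar polynomial is a polynomial over $\mathbb{F}$ whose induced function is planar. An Alltop type polynomial over $\mathbb{F}$ is a polynomial $f$ over $\mathbb{F}$ such that for each $a \in \mathbb{F}^*$ one has $\Delta_{fa}(x) = \Pi_a(x)$ for some planar polynomial $\Pi_a$. *)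

(* Defs.v *)
From HB Require Import structures.
From mathcomp Require Import all_boot all_order all_algebra.

Set Implicit Arguments.
Unset Strict Implicit.
Unset Printing Implicit Defensive.

Import GRing.Theory.
Local Open Scope ring_scope.

Definition delta (F : finFieldType) (f : F -> F) (a : F) : F -> F :=
  fun x => f (x + a) - f x.

Definition planar (F : finFieldType) (P : F -> F) : Prop :=
  forall b : F, b != 0 -> bijective (delta P b).

Definition planar_poly (F : finFieldType) (p : {poly F}) : Prop :=
  planar (fun x => p.[x]).

(* The equation between the difference of f and the planar polynomial is an
   equality of functions on F, not of formal polynomials. *)
Definition alltop_poly (F : finFieldType) (f : {poly F}) : Prop :=
  forall a : F, a != 0 ->
    exists2 p : {poly F}, planar_poly p & delta (fun x => f.[x]) a =1 horner p.

(* Main.v *)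
Require Import Defs.
From mathcomp Require Import all_boot all_order all_algebra.
From mathcomp Require Import finfield ring.

(** In characteristic 3 the second difference of any function in a repeated
    direction [a] is [f (x + 2 a) - 2 f (x + a) + f x], that is the sum
    [f x + f (x + a) + f (x + 2 a)] of [f] over, for nonzero [a], a coset of
    the line spanned by [a] over the prime field.  It is therefore periodic of
    period [a] ([delta_delta_periodic]), hence not injective when [a] is
    nonzero, whereas planarity of the first difference would make it a
    bijection. *)

Set Implicit Arguments.
Unset Strict Implicit.
Unset Printing Implicit Defensive.

Import GRing.Theory.
Local Open Scope ring_scope.

(** Adding [a] three times is the identity, so it rotates the three terms
    of the sum that the second difference becomes once [- 2] is read as [1]. *)
Lemma delta_delta_periodic (F : finFieldType) (char3 : 3%N \in [pchar F])
    (f : F -> F) (a x : F) :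
  delta (delta f a) a (x + a) = delta (delta f a) a x.
Proof.
have F3 : 3%:R = 0 :> F := pcharf0 char3.
have -> : delta (delta f a) a (x + a) =
    f (x + 3%:R * a) - 2%:R * f (x + a + a) + f (x + a).
  rewrite /delta (_ : x + a + a + a = x + 3%:R * a); last by ring.
  by ring.
rewrite F3 mul0r addr0 /delta.
apply/eqP; rewrite -subr_eq0; apply/eqP.
transitivity (3%:R * (f (x + a) - f (x + a + a))); first by ring.
by rewrite F3 mul0r.
Qed.

Theorem theorem15 (r : nat) (hr : (1 <= r)%N) (F : finFieldType)
    (hF : #|F| = (3 ^ r)%N) :
  ~ exists f : {poly F}, alltop_poly f.
Proof.
have char3 : 3%N \in [pchar F] := card_finPcharP hF isT.
case=> f /(_ 1 (oner_neq0 F)) [p /(_ 1 (oner_neq0 F)) /bij_inj inj_dp eq_fp].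
have eq_d x : delta (horner p) 1 x = delta (delta (horner f) 1) 1 x.
  by rewrite /delta -!eq_fp.
have /inj_dp/eqP : delta (horner p) 1 (0 + 1) = delta (horner p) 1 0.
  by rewrite !eq_d delta_delta_periodic.
by rewrite add0r oner_eq0.
Qed.
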